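(* Let $N\ge 1$ be an integer, let $1\le p<\infty$, let $(\Omega,\mathcal{A},\mu)$ be a submodular capacity space and let $F:[0,1]^{N}\to L^{p}(\Omega,\mathcal{A},\mu)$ be a random function. Then for all $x_{1},\dots,x_{N}\in[0,1]$ and all $n_{1},\dots,n_{N}\in\mathbb{N}$ (positive integers), $$\left[(C)\int_{\Omega}\left|F(x_{1},\dots,x_{N},\omega)-B_{n_{1},\dots,n_{N}}(F)(x_{1},\dots,x_{N},\omega)\right|^{p}\,\mathrm{d}\mu\right]^{1/p}\le [C_{p}]^{1/p}\cdot\Gamma\left(F;\frac{1}{\sqrt{n_{1}}},\dots,\frac{1}{\sqrt{n_{N}}}\right)_{p},$$ where $C_{p}$ is a constant independent of $n_{1},\dots,n_{N}$ and of $x_{1},\dots,x_{N}$. If, moreover, $F$ is continuous in the Choquet-mean of order $p$ at each $\mathbf{x}\in[0,1]^{N}$, then the random Bernstein polynomials $B_{n_{1},\dots,n_{N}}(F)$ converge uniformly to $F$ in the Choquet-mean of order $p$ as $\min\{n_{1},\dots,n_{N}\}\to\infty$; that is, for every $\varepsilon>0$ there is $n_{0}\in\mathbb{N}$ such that $(C)\int_{\Omega}|B_{n_{1},\dots,n_{N}}(F)(\mathbf{x},\omega)-F(\mathbf{x},\omega)|^{p}\,\mathrm{d}\mu<\varepsilon$ for all $\mathbf{x}\in[0,1]^{N}$ and all $n_{1},\dots,n_{N}\ge n_{0}$.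
   Context: Capacity. Let $\mathcal{A}$ be a $\sigma$-algebra of subsets of a nonempty set $\Omega$. A capacity is a set function $\mu:\mathcal{A}\to\mathbb{R}_{+}$ with $\mu(\emptyset)=0$, $\mu(\Omega)=1$ and $\mu(A)\le\mu(B)$ whenever $A\subset B$, $A,B\in\mathcal{A}$. It is submodular if $\mu(A\cup B)+\mu(A\cap B)\le\mu(A)+\mu(B)$ for all $A,B\in\mathcal{A}$. A (submodular) capacity space is a triple $(\Omega,\mathcal{A},\mu)$ with $\mu$ a (submodular) capacity. Choquet integral. For an $\mathcal{A}$-measurable $f:\Omega\to[0,\infty)$ and $A\in\mathcal{A}$, $(C)\int_{A}f\,\mathrm{d}\mu=\int_{0}^{\infty}\mu(\{\omega:f(\omega)>t\}\cap A)\,\mathrm{d}t$ (improper Riemann integral, possibly $+\infty$). Spaces. $\mathcal{L}^{p}(\Omega,\mathcal{A},\mu)$ is the set of $\mathcal{A}$-measurable $f:\Omega\to\mathbb{R}$ with $(C)\int_{\Omega}|f|^{p}\,\mathrm{d}\mu<\infty$, and $L^{p}(\Omega,\mathcal{A},\mu)$ is its quotient by $\mathcal{N}_{p}=\{f\in\mathcal{L}^{p}(\Omega,\mathcal{A},\mu):(C)\int_{\Omega}|f|^{p}\,\mathrm{d}\mu=0\}$; for $\mu$ submodular it is normed by $\|f\|=\left((C)\int_{\Omega}|f|^{p}\,\mathrm{d}\mu\right)^{1/p}$. Random functions. A random function on $D\subset\mathbb{R}^{N}$ is a map $F$ from $D$ to the random variables ($\mathcal{A}$-measurable real functions) on $\Omega$,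 and one writes $F(\mathbf{x},\omega)=F(\mathbf{x})(\omega)$. $F:D\to L^{p}(\Omega,\mathcal{A},\mu)$ is continuous in the Choquet-mean of order $p$ at $\mathbf{x}_{0}\in D$ if for every $\varepsilon>0$ there is $\delta>0$ such that $(C)\int_{\Omega}|F(\mathbf{x},\omega)-F(\mathbf{x}_{0},\omega)|^{p}\,\mathrm{d}\mu<\varepsilon$ for all $\mathbf{x}\in D$ with $\|\mathbf{x}-\mathbf{x}_{0}\|<\delta$. Modulus of continuity. For $\delta_{1},\dots,\delta_{N}\ge 0$, the multivariate Choquet $L^{p}$-modulus of continuity is $$\Gamma(F;\delta_{1},\dots,\delta_{N})_{p}=\left(\sup_{|t_{i}-s_{i}|\le\delta_{i},\,i=1,\dots,N}(C)\int_{\Omega}|F(t_{1},\dots,t_{N},\omega)-F(s_{1},\dots,s_{N},\omega)|^{p}\,\mathrm{d}\mu(\omega)\right)^{1/p},$$ the supremum being over points $(t_{i})_i,(s_{i})_i$ of the domain of $F$. Random Bernstein polynomials. $$B_{n_{1},\dots,n_{N}}(F)(x_{1},\dots,x_{N},\omega)=\sum_{k_{1}=0}^{n_{1}}\cdots\sum_{k_{N}=0}^{n_{N}}p_{k_{1},n_{1}}(x_{1})\cdots p_{k_{N},n_{N}}(x_{N})\,F\left(\frac{k_{1}}{n_{1}},\dots,\frac{k_{N}}{n_{N}},\omega\right),$$ where $p_{k,n}(x)=\binom{n}{k}x^{k}(1-x)^{n-k}$. *)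

(* Defs.v *)
From mathcomp Require Export all_boot all_order all_algebra.
From mathcomp Require Export all_classical all_reals all_analysis.

Set Implicit Arguments.
Unset Strict Implicit.
Unset Printing Implicit Defensive.

Import Order.TTheory GRing.Theory Num.Theory.
Import numFieldNormedType.Exports.

Local Open Scope classical_set_scope.
Local Open Scope ring_scope.

(* A set function is a total [set Omega -> R]; only its values on the
   sigma-algebra are constrained.  [Omega] is nonempty because a
   [measurableType] is pointed. *)
Definition is_capacity (R : realType) (d : measure_display)
    (Omega : measurableType d) (mu : set Omega -> R) : Prop :=
  [/\ forall A, measurable A -> 0 <= mu A,
      mu set0 = 0,
      mu setT = 1 &
      forall A B, measurable A -> measurable B -> A `<=` B -> mu A <= mu B].

Definition is_submodular (R : realType) (d : measure_display)
    (Omega : measurableType d) (mu : set Omega -> R) : Prop :=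
  forall A B, measurable A -> measurable B ->
    mu (A `|` B) + mu (A `&` B) <= mu A + mu B.

(* The integrand is nonnegative and nonincreasing in t (for f measurable), so
   this Lebesgue integral is the improper Riemann integral over [0, +oo), with
   value +oo exactly when the latter diverges. *)
Definition choquet (R : realType) (d : measure_display)
    (Omega : measurableType d) (mu : set Omega -> R)
    (A : set Omega) (f : Omega -> R) : \bar R :=
  (\int[lebesgue_measure]_(t in `[0%R, +oo[)
     (mu ([set omega | (t < f omega)%R] `&` A))%:E)%E.

(* The space of functions, before the quotient by those of zero seminorm. *)
Definition in_Lp (R : realType) (d : measure_display)
    (Omega : measurableType d) (mu : set Omega -> R) (p : R)
    (f : Omega -> R) : Prop :=
  measurable_fun setT f /\
  (choquet mu setT (fun omega => (`|f omega| `^ p)%R) < +oo)%E.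

(* A random function on D with values in L^p is given by representatives: F is
   total on R^N, but only its values on D matter. *)
Definition random_function_Lp (R : realType) (d : measure_display)
    (Omega : measurableType d) (mu : set Omega -> R) (p : R) (N : nat)
    (D : set 'rV[R]_N) (F : 'rV[R]_N -> Omega -> R) : Prop :=
  forall x, D x -> in_Lp mu p (F x).

Definition unit_cube (R : realType) (N : nat) : set 'rV[R]_N :=
  [set x | forall i, 0 <= x 0 i <= 1].

(* The library norm on ['rV[R]_N] is the sup norm. *)
Definition euclidean_norm (R : realType) (N : nat) (x : 'rV[R]_N) : R :=
  Num.sqrt (\sum_(i < N) x 0 i ^+ 2).

Definition choquet_mean_continuous_at (R : realType) (d : measure_display)
    (Omega : measurableType d) (mu : set Omega -> R) (p : R) (N : nat)
    (D : set 'rV[R]_N) (F : 'rV[R]_N -> Omega -> R) (x0 : 'rV[R]_N) : Prop :=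
  forall eps : R, 0 < eps -> exists2 delta : R, 0 < delta &
    forall x, D x -> euclidean_norm (x - x0) < delta ->
      (choquet mu setT (fun omega => (`|F x omega - F x0 omega| `^ p)%R)
         < eps%:E)%E.

(* Extended-real valued: the supremum may be +oo, and [+oo `^ p^-1 = +oo]. *)
Definition choquet_modulus (R : realType) (d : measure_display)
    (Omega : measurableType d) (mu : set Omega -> R) (p : R) (N : nat)
    (D : set 'rV[R]_N) (F : 'rV[R]_N -> Omega -> R)
    (delta : 'I_N -> R) : \bar R :=
  (ereal_sup [set y | exists t s : 'rV[R]_N,
     [/\ D t, D s, forall i, (`|t 0 i - s 0 i| <= delta i)%R &
         y = choquet mu setT (fun omega => (`|F t omega - F s omega| `^ p)%R)]]
   `^ p^-1)%E.

Definition bernstein_basis (R : realType) (k n : nat) (x : R) : R :=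
  'C(n, k)%:R * x ^+ k * (1 - x) ^+ (n - k).

(* The N-fold sum over 0 <= k_i <= n_i is a single sum over the multi-indices k,
   i.e. dependent finite functions with [k i : 'I_(n i).+1]. *)
Definition random_bernstein (R : realType) (Omega : Type) (N : nat)
    (n : 'I_N -> nat) (F : 'rV[R]_N -> Omega -> R)
    (x : 'rV[R]_N) (omega : Omega) : R :=
  \sum_(k : {dffun forall i : 'I_N, 'I_(n i).+1})
    (\prod_(i < N) bernstein_basis (k i) (n i) (x 0 i)) *
    F (\row_(i < N) ((k i)%:R / (n i)%:R)) omega.

(* Main.v *)
Require Import Defs.
From mathcomp Require Import ring lra measurable_realfun.
Import Order.TTheory GRing.Theory Num.Theory.
Import numFieldNormedType.Exports.
Local Open Scope classical_set_scope.
Local Open Scope ring_scope.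

Set Implicit Arguments.
Unset Strict Implicit.
Unset Printing Implicit Defensive.

(** The error F(x) - B_n(F)(x) is the weighted mean of the increments
    F(x) - F(k/n), with the Bernstein weights, which add up to 1.  Two facts
    about the Choquet integral of a submodular capacity turn this into the
    estimate: it is subadditive and positively homogeneous.  With the convexity
    of t |-> t^p they give a Jensen inequality ([choquet_jensen]), so that the
    p-th mean of the error is at most the weighted mean of the p-th means of
    the increments.

    Subadditivity ([choquet_sum_le]) rests on a combinatorial inequality: for
    finitely many sets A_j, the capacities of the sets of points lying in at
    least i of the A_j, summed over i >= 1, add up to at most the sum of the
    mu(A_j) ([sum_multiplicity_ge_le]).  This is submodularity, telescoped while
    the sets are added one at a time.  Applied to the level sets {g_k > j e} it
    compares lower Riemann sums, which determine the Choquet integral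
    ([lower_sum_le_choquet], [choquet_le_of_lower_sum]).

    An increment between x and k/n is split into m equal steps, each within the
    scale 1/sqrt(n_i) in every coordinate; its p-th mean is then at most m^p
    times the p-th power of the modulus ([choquet_increment_le]).  One can take
    m <= 1 + Y, where Y is the sum of the sqrt(n_i)|k_i/n_i - x_i|.  Since
    m^p <= p^p exp(m), it remains to bound the mean of exp(Y) under the product
    of the binomial laws, uniformly in n and x; that mean factors over the
    coordinates, and each factor is at most 2 exp(2)
    ([bernstein_weight_exp_moment]).  Hence the constant
    C_p = p^p e (2 e^2)^N.

    For the convergence, the cube is compact, so continuity in the mean at each
    point is uniform and the modulus tends to 0
    ([choquet_oscillation_small]). *)

(** * Multiplicities of finite families of sets *)

(** The recursion makes explicit how a multiplicity level changes when one set
    is added, which is the form in which submodularity applies to it. *)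
Fixpoint multiplicity_ge (T : Type) (s : seq (set T)) (i : nat) : set T :=
  match s, i with
  | _, 0%N => setT
  | [::], _.+1 => set0
  | A :: s', i'.+1 => multiplicity_ge s' i'.+1 `|` (multiplicity_ge s' i' `&` A)
  end.

Lemma multiplicity_ge0 (T : Type) (s : seq (set T)) :
  multiplicity_ge s 0 = setT.
Proof. by case: s. Qed.

Lemma multiplicity_geP (T : Type) (s : seq (set T)) (i : nat) (x : T) :
  multiplicity_ge s i x <-> (i <= count (fun A => `[< A x >]) s)%N.
Proof.
elim: s i => [|A s IH] [|i] //=.
change (multiplicity_ge s i.+1 x \/ (multiplicity_ge s i x /\ A x) <->
  (i.+1 <= `[< A x >] + count (fun A => `[< A x >]) s)%N).
rewrite !IH; case: asboolP => Ax /=; rewrite ?add1n ?add0n ?ltnS.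
  by split; [case=> [/ltnW|[]]|right].
by split; [case=> // -[]|left].
Qed.

Lemma multiplicity_ge_decr (T : Type) (s : seq (set T)) (i : nat) :
  multiplicity_ge s i.+1 `<=` multiplicity_ge s i.
Proof. by move=> x /multiplicity_geP/ltnW/multiplicity_geP. Qed.

Lemma measurable_multiplicity_ge (d : measure_display) (T : measurableType d)
    (s : seq (set T)) (i : nat) :
  (forall A, A \in s -> measurable A) -> measurable (multiplicity_ge s i).
Proof.
elim: s i => [|A s IH] [|i] //= mS.
have mA : measurable A by apply: mS; rewrite mem_head.
have {}IH j : measurable (multiplicity_ge s j).
  by apply: IH => B sB; apply: mS; rewrite in_cons sB orbT.
by apply: measurableU => //; apply: measurableI.
Qed.

(** When A is added, the level L_(i+1) becomes L_(i+1) U (L_i n A), and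
    submodularity bounds its capacity by
    mu(L_(i+1)) + mu(L_i n A) - mu(L_(i+1) n A), because the levels decrease.
    The last two terms telescope in i, from L_0 n A = A. *)
Lemma sum_multiplicity_ge_le (R : realType) (d : measure_display)
    (T : measurableType d) (mu : set T -> R) (s : seq (set T)) (m : nat) :
  is_capacity mu -> is_submodular mu ->
  (forall A, A \in s -> measurable A) ->
  \sum_(i < m) mu (multiplicity_ge s i.+1) <= \sum_(A <- s) mu A.
Proof.
move=> [mu_ge0 mu0 _ _] submu; elim: s => [|A s IH] mS /=.
  by rewrite big_nil big1.
have mA : measurable A by apply: mS; rewrite mem_head.
have mS' B : B \in s -> measurable B
  by move=> sB; apply: mS; rewrite in_cons sB orbT.
have mL i : measurable (multiplicity_ge s i) by exact: measurable_multiplicity_ge.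
have telescope : \sum_(i < m) mu (multiplicity_ge (A :: s) i.+1)
      + mu (multiplicity_ge s m `&` A)
    <= \sum_(i < m) mu (multiplicity_ge s i.+1) + mu A.
  elim: m {IH} => [|m IHm].
    by rewrite !big_ord0 multiplicity_ge0 setTI.
  rewrite !big_ord_recr /=.
  have := submu _ _ (mL m.+1) (measurableI _ _ (mL m) mA).
  (* The intersection L_(m+1) n (L_m n A) is L_(m+1) n A. *)
  rewrite setIA (setIidl (@multiplicity_ge_decr _ s m)).
  by move: IHm => /=; lra.
have := mu_ge0 _ (measurableI _ _ (mL m) mA).
rewrite big_cons; move: telescope (IH mS') => /=; lra.
Qed.

(** * Lower Riemann sums of nonincreasing functions *)

Lemma integral_itv_nonincreasing (R : realType) (phi : R -> R) (e : R) (M : nat) :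
  0 < e -> (forall t, 0 <= phi t) -> {homo phi : s t / s <= t >-> t <= s} ->
  ((e * \sum_(i < M) phi (i.+1%:R * e))%:E
     <= \int[lebesgue_measure]_(t in `[0%R, (M%:R * e)%R[) (phi t)%:E
     <= (e * \sum_(i < M) phi (i%:R * e))%:E)%E.
Proof.
move=> e0 phi0 phi_ni.
have mphi (D : set R) : measurable D ->
    measurable_fun D (EFin \o phi).
  move=> mD; apply/measurable_EFinP.
  by apply: nonincreasing_measurable => // s t ts; exact: phi_ni.
elim: M => [|M IH].
  by rewrite !big_ord0 mulr0 mul0r set_itvco0 integral_set0 lexx.
have ab : (M%:R * e <= M.+1%:R * e)%R by rewrite ler_pM2r// ler_nat.
have -> : `[0, M.+1%:R * e[%classic = 
   `[0, M%:R * e[%classic `|` `[M%:R * e, M.+1%:R * e[%classic :> set R.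
  by rewrite -itv_bndbnd_setU// bnd_simp// mulr_ge0// ltW.
rewrite ge0_integral_setU//=; last 3 first.
- by apply: mphi; apply: measurableU.
- by move=> x _; rewrite lee_fin.
- rewrite disj_set2E; apply/eqP/seteqP; split => // t [] /=.
  rewrite !in_itv/= => /andP[_ t1] /andP[t2 _].
  by move: (lt_le_trans t1 t2); rewrite ltxx.
rewrite !big_ord_recr /= !mulrDr !EFinD.
have cst_int (c : R) : (\int[lebesgue_measure]_(t in
    (`[(M%:R * e)%R, (M.+1%:R * e)%R[%classic : set R)) c%:E = (e * c)%:E)%E.
  rewrite integral_cst//= lebesgue_measure_itv /= lte_fin ltr_pM2r// ltr_nat ltnSn.
  by rewrite -EFinB -mulrBl -natrB// subSnn mul1r -EFinM mulrC.
move: IH => /andP[IH1 IH2]; apply/andP; split; apply: leeD => //.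
- rewrite -cst_int.
  apply: (@ge0_le_integral _ _ _ lebesgue_measure `[_, _[%classic _
    (fun=> (phi (M.+1%:R * e))%:E) (EFin \o phi)).
  + by [].
  + by move=> t _; rewrite lee_fin.
  + exact: measurable_cst.
  + exact: mphi.
  + by move=> t; rewrite /= in_itv/= lee_fin => /andP[_ /ltW]; exact: phi_ni.
- rewrite -cst_int.
  apply: (@ge0_le_integral _ _ _ lebesgue_measure `[_, _[%classic _
    (EFin \o phi) (fun=> (phi (M%:R * e))%:E)).
  + by [].
  + by move=> t _; rewrite lee_fin.
  + exact: mphi.
  + exact: measurable_cst.
  + by move=> t; rewrite /= in_itv/= lee_fin => /andP[+ _]; exact: phi_ni.
Qed.

Lemma le_integral_subset (R : realType) (phi : R -> R) (A B : set R) :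
  measurable A -> measurable B -> measurable_fun B (EFin \o phi) ->
  (forall t, 0 <= phi t) -> A `<=` B ->
  (\int[lebesgue_measure]_(t in A) (phi t)%:E
     <= \int[lebesgue_measure]_(t in B) (phi t)%:E)%E.
Proof.
move=> mA mB mphi phi0 AB.
have phi0' t : B t -> (0 <= (phi t)%:E)%E by rewrite lee_fin.
exact: (@ge0_subset_integral _ _ _ lebesgue_measure A B mA mB (EFin \o phi)).
Qed.

Lemma integral_pinfty_le (R : realType) (phi : R -> R) (c : \bar R) :
  measurable_fun (setT : set R) phi -> (forall t, 0 <= phi t) ->
  (forall n : nat,
    (\int[lebesgue_measure]_(t in `[0%R, n%:R[) (phi t)%:E <= c)%E) ->
  (\int[lebesgue_measure]_(t in `[0%R, +oo[) (phi t)%:E <= c)%E.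
Proof.
move=> mphi phi0 le_c.
have mphi' (D : set R) : measurable D -> measurable_fun D (EFin \o phi).
  by move=> mD; apply: measurable_funTS; exact/measurable_EFinP.
have <- : \bigcup_n `[0%R, n%:R[%classic = `[0%R, +oo[%classic :> set R.
  apply/seteqP; split=> t /=.
    by move=> [n _] /=; rewrite !in_itv/= => /andP[->].
  rewrite in_itv/= andbT => t0; exists (Num.truncn t).+1 => //=.
  by rewrite in_itv/= t0 truncnS_gt.
have itv_sub (m n : nat) : (m <= n)%N -> 
    (`[0, m%:R[%classic : set R) `<=` `[0, n%:R[%classic.
  move=> mn t /=; rewrite !in_itv/= => /andP[->] tm.
  by rewrite (lt_le_trans tm)// ler_nat.
have cvgI : (fun n : nat =>
    \int[lebesgue_measure]_(t in `[0%R, n%:R[%classic) (phi t)%:E)%E @ \oo -->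
    (\int[lebesgue_measure]_(t in \bigcup_n `[0%R, n%:R[%classic) (phi t)%:E)%E.
  apply: (@ge0_nondecreasing_set_cvg_integral _ (measurableTypeR R) _
    (fun n => `[0%R, n%:R[%classic) (EFin \o phi) lebesgue_measure).
  - by move=> m n mn; apply/subsetPset; exact: itv_sub.
  - by move=> n; exact: measurable_itv.
  - by move=> n; apply: mphi'; exact: measurable_itv.
  - by move=> n t _; rewrite /= lee_fin; exact: phi0.
rewrite -(cvg_lim _ cvgI)//; apply: lime_le; last exact: nearW.
by apply/cvg_ex; eexists; exact: cvgI.
Qed.

(** * The Choquet integral through lower sums *)

Definition survival (R : realType) (T : Type) (mu : set T -> R) (f : T -> R)
    (t : R) : R :=
  mu [set x | t < f x].

Definition lower_sum (R : realType) (T : Type) (mu : set T -> R) (f : T -> R)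
    (e : R) (M : nat) : R :=
  e * \sum_(i < M) survival mu f (i.+1%:R * e).

Lemma measurable_superlevel (R : realType) (d : measure_display)
    (T : measurableType d) (f : T -> R) (t : R) :
  measurable_fun setT f -> measurable [set x | t < f x].
Proof.
move=> mf; rewrite -[X in measurable X]setTI.
have -> : [set x | t < f x] = f @^-1` `]t, +oo[%classic.
  by apply/seteqP; split=> x /=; rewrite in_itv/= andbT.
exact: mf.
Qed.

Lemma choquetE (R : realType) (d : measure_display) (T : measurableType d)
    (mu : set T -> R) (f : T -> R) :
  choquet mu setT f =
  (\int[lebesgue_measure]_(t in `[0%R, +oo[) (survival mu f t)%:E)%E.
Proof. by rewrite /choquet; apply: eq_integral => t _; rewrite setIT. Qed.

Section capacity.
Context (R : realType) (d : measure_display) (T : measurableType d).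
Variable mu : set T -> R.
Hypothesis cap : is_capacity mu.

Lemma survival_ge0 (f : T -> R) (t : R) :
  measurable_fun setT f -> 0 <= survival mu f t.
Proof. by case: cap => mu_ge0 _ _ _ mf; exact/mu_ge0/measurable_superlevel. Qed.

Lemma survival_le1 (f : T -> R) (t : R) :
  measurable_fun setT f -> survival mu f t <= 1.
Proof.
case: cap => _ _ <- mu_le mf; apply: mu_le => //; exact: measurable_superlevel.
Qed.

Lemma survival_nonincreasing (f : T -> R) :
  measurable_fun setT f ->
  {homo survival mu f : s t / s <= t >-> t <= s}.
Proof.
case: cap => _ _ _ mu_le mf s t st.
apply: mu_le; try exact: measurable_superlevel.
by move=> x /=; exact: le_lt_trans.
Qed.

Lemma measurable_survival (f : T -> R) (D : set R) :
  measurable_fun setT f -> measurable D ->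
  measurable_fun D (EFin \o survival mu f).
Proof.
move=> mf mD; apply/measurable_EFinP.
by apply: nonincreasing_measurable => // s t ts; exact: survival_nonincreasing.
Qed.

Lemma lower_sum_le_choquet (f : T -> R) (e : R) (M : nat) :
  measurable_fun setT f -> 0 < e ->
  ((lower_sum mu f e M)%:E <= choquet mu setT f)%E.
Proof.
move=> mf e0; rewrite choquetE.
have /andP[+ _] := integral_itv_nonincreasing M e0
  (fun t => survival_ge0 t mf) (survival_nonincreasing mf).
move=> /le_trans; apply.
apply: le_integral_subset => //.
- exact: measurable_survival.
- by move=> t; exact: survival_ge0.
- by move=> t /=; rewrite !in_itv/= => /andP[->].
Qed.

(** On [0, M e) the upper Riemann sum exceeds the lower one by at most e, since
    the survival function is at most 1.  The slack K e, which disappears as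
    e -> 0, absorbs discretization errors such as the one in the proof of
    subadditivity. *)
Lemma choquet_le_of_lower_sum (f : T -> R) (c : \bar R) (K : R) :
  measurable_fun setT f -> 0 <= K ->
  (forall e M, 0 < e -> ((lower_sum mu f e M)%:E <= c + (K * e)%:E)%E) ->
  (choquet mu setT f <= c)%E.
Proof.
move=> mf K0 lower_le; rewrite choquetE.
apply: integral_pinfty_le => [|t|n].
- by apply/measurable_EFinP; exact: measurable_survival.
- exact: survival_ge0.
apply/lee_addgt0Pr => eps eps0.
(* This mesh makes the total error K e + e equal to eps. *)
pose e := eps / (K + 1).
have K1 : 0 < K + 1 by lra.
have e0 : 0 < e by exact: divr_gt0.
pose M := (Num.truncn (n%:R / e)).+1.
have nM : n%:R <= M%:R * e.
  by rewrite -ler_pdivrMr// ltW// truncnS_gt.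
have /andP[_ upper] := integral_itv_nonincreasing M e0
  (fun t => survival_ge0 t mf) (survival_nonincreasing mf).
apply: (@le_trans _ _ (\int[lebesgue_measure]_(t in
    `[0%R, (M%:R * e)%R[%classic) (survival mu f t)%:E)%E).
  apply: le_integral_subset => //.
  - exact: measurable_survival.
  - by move=> t; exact: survival_ge0.
  - move=> t /=; rewrite !in_itv/= => /andP[->] tm.
    exact: lt_le_trans tm nM.
apply: (le_trans upper).
have -> : eps = (K * e + e)%R by rewrite /e; field; rewrite gt_eqF.
rewrite EFinD addeA.
apply: (@le_trans _ _ ((lower_sum mu f e M)%:E + e%:E)%E); last first.
  by apply: leeD => //; exact: lower_le.
rewrite -EFinD lee_fin /lower_sum /M big_ord_recl big_ord_recr /= mulrDr.
rewrite [X in _ <= X]addrC; apply: lerD.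
  by rewrite ler_piMr// ?survival_le1// ltW.
rewrite ler_pM2l// lerDl//.
exact: survival_ge0.
Qed.

Lemma choquet_ge0 (f : T -> R) :
  measurable_fun setT f -> (0 <= choquet mu setT f)%E.
Proof.
move=> mf; have := lower_sum_le_choquet 0 mf ltr01.
by rewrite /lower_sum big_ord0 mulr0.
Qed.

Lemma choquet_le (f g : T -> R) :
  measurable_fun setT f -> measurable_fun setT g ->
  (forall x, f x <= g x) -> (choquet mu setT f <= choquet mu setT g)%E.
Proof.
move=> mf mg fg; apply: (@choquet_le_of_lower_sum _ _ 0) => // e M e0.
rewrite mul0r adde0; apply: le_trans (lower_sum_le_choquet M mg e0).
rewrite lee_fin ler_pM2l//; apply: ler_sum => i _.
case: cap => _ _ _; apply; try exact: measurable_superlevel.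
by move=> x /= /lt_le_trans; apply.
Qed.

(** The lower sum of w f with mesh e is w times the lower sum of f with mesh
    e / w, so no change of variables in the integral is involved. *)
Lemma choquet_scale_le (f : T -> R) (w : R) :
  measurable_fun setT f -> 0 <= w ->
  (choquet mu setT (fun x => w * f x)%R <= w%:E * choquet mu setT f)%E.
Proof.
move=> mf; have mwf v : measurable_fun setT (fun x => v * f x).
  exact: measurable_funM.
rewrite le_eqVlt => /predU1P[<-|w0].
  rewrite mul0e; apply: (@choquet_le_of_lower_sum _ _ 0) => // e M e0.
  rewrite mul0r adde0 lee_fin /lower_sum big1 ?mulr0// => i _.
  rewrite /survival (_ : [set _ | _] = set0); first by case: cap.
  by apply/seteqP; split=> // x /=; rewrite mul0r ltNge mulr_ge0// ltW.
apply: (@choquet_le_of_lower_sum _ _ 0) => // e M e0.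
rewrite mul0r adde0.
have := lower_sum_le_choquet M mf (divr_gt0 e0 w0).
rewrite -(@lee_pmul2l _ w%:E)// ?lte_fin// => /(le_trans _); apply.
rewrite -EFinM lee_fin /lower_sum mulrA [w * _]mulrC divfK ?gt_eqF//.
rewrite ler_pM2l//; apply: ler_sum => i _.
rewrite /survival.
rewrite (_ : [set x | _ < w * f x] = [set x | i.+1%:R * (e / w) < f x])//.
by apply/seteqP; split=> x /=; rewrite mulrA ltr_pdivrMr// mulrC [_ * w]mulrC.
Qed.

End capacity.

(** * Subadditivity of the Choquet integral *)

(** The number c of grid points j e (1 <= j <= M) below g bounds g up to one
    mesh from above, unless the count is saturated. *)
Lemma grid_count_bound (R : realType) (e g : R) (M : nat) :
  0 < e -> let c := (\sum_(j < M) (j.+1%:R * e < g)%R)%N in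
  c = M \/ g <= c.+1%:R * e.
Proof.
move=> e0 /=; elim: M => [|M IH]; first by left; rewrite big_ord0.
have cM : (\sum_(j < M) (j.+1%:R * e < g)%R <= M)%N.
  by rewrite -[leqRHS]card_ord -sum1_card leq_sum// => j _; case: (_ < _).
rewrite big_ord_recr /=; case: IH => [->|gle].
  by case: ltP => [_|gle]; [left; rewrite addn1 | right; rewrite addn0].
right; have gM : g <= M.+1%:R * e.
  by rewrite (le_trans gle)// ler_pM2r// ler_nat ltnS.
by rewrite ltNge gM addn0.
Qed.

Section submodular.
Context (R : realType) (d : measure_display) (T : measurableType d).
Variable mu : set T -> R.
Hypotheses (cap : is_capacity mu) (submu : is_submodular mu).

(** Replacing each g_k by the number of grid points below it loses at most one
    mesh e per index, hence #|I| e in the sum: the level of the sum at height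
    (#|I| + i + 1) e lies in the multiplicity level i + 1 of the family of the sets
    {g_k > j e}, which the multiplicity inequality controls.  The first #|I|
    terms of the lower sum, each at most e, are the price. *)
Lemma choquet_sum_le (I : finType) (g : I -> T -> R) :
  (forall k, measurable_fun setT (g k)) -> (forall k x, 0 <= g k x) ->
  (choquet mu setT (fun x => \sum_k g k x)%R
     <= \sum_k choquet mu setT (g k))%E.
Proof.
move=> mg g0; set h := fun x => \sum_k g k x.
have mh : measurable_fun setT h by exact: measurable_sum.
apply: (@choquet_le_of_lower_sum _ _ _ _ cap _ _ #|I|%:R) => // e M e0.
pose A (k : I) (j : nat) := [set x | j.+1%:R * e < g k x].
pose s := [seq A k j | k <- enum I, j <- iota 0 M].
have mA k j : measurable (A k j) by exact: measurable_superlevel.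
have ms B : B \in s -> measurable B by case/allpairsP => -[k j] [_ _ ->].
have superlevel i : (i < M)%N ->
    [set x | (#|I| + i).+1%:R * e < h x] `<=` multiplicity_ge s i.+1.
  move=> iM x /= hx; apply/multiplicity_geP.
  have -> : count (fun B => `[< B x >]) s =
      (\sum_k \sum_(j < M) (j.+1%:R * e < g k x)%R)%N.
    rewrite /s count_flatten sumnE big_map big_map big_enum /=.
    apply: eq_bigr => k _; rewrite count_map -sum1_count big_mkcond /=.
    rewrite -[in LHS](subn0 M) -/(index_iota 0 M) big_mkord.
    by apply: eq_bigr => j _; rewrite /= asboolb; case: (_ < _).
  set c := fun k => (\sum_(j < M) (j.+1%:R * e < g k x)%R)%N.
  (* A saturated count M > i alone gives the required multiplicity. *)
  have [[k ck]|noM] := pselect (exists k, c k = M).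
    by rewrite (bigD1 k)//= -/(c k) ck ltn_addr.
  rewrite ltnNge; apply/negP => cle; move: hx; apply/negP; rewrite -leNgt.
  apply: (@le_trans _ _ (\sum_k (c k).+1%:R * e)).
    apply: ler_sum => k _; have [/= ck|//] := grid_count_bound (g k x) M e0.
    by case: noM; exists k.
  rewrite -mulr_suml ler_pM2r// -natr_sum ler_nat.
  under eq_bigr do rewrite -addn1.
  rewrite big_split /= sum1_card addnC -addnS leq_add2l.
  exact: leqW.
have levels : \sum_(i < M) survival mu h ((#|I| + i).+1%:R * e)
    <= \sum_k \sum_(j < M) survival mu (g k) (j.+1%:R * e).
  apply: (@le_trans _ _ (\sum_(i < M) mu (multiplicity_ge s i.+1))).
    apply: ler_sum => i _; case: cap => _ _ _; apply.
    - exact: measurable_superlevel.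
    - exact: measurable_multiplicity_ge.
    - exact: superlevel.
  apply: (le_trans (sum_multiplicity_ge_le M cap submu ms)).
  rewrite /s big_flatten big_map big_enum /=; apply: ler_sum => k _.
  by rewrite big_map -[in leLHS](subn0 M) -/(index_iota 0 M) big_mkord.
have dropK : \sum_(i < M) survival mu h (i.+1%:R * e) <=
    #|I|%:R + \sum_(i < M) survival mu h ((#|I| + i).+1%:R * e).
  have surv0 t : 0 <= survival mu h t by exact: survival_ge0.
  apply: (@le_trans _ _ (\sum_(i < #|I| + M) survival mu h (i.+1%:R * e))).
    by rewrite addnC big_split_ord /= lerDl sumr_ge0.
  rewrite big_split_ord /= lerD2r -[leRHS](_ : \sum_(i < #|I|) 1 = _).
    by apply: ler_sum => i _; exact: survival_le1.
  by rewrite sumr_const card_ord.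
apply: (@le_trans _ _ (\sum_k (lower_sum mu (g k) e M)%:E + (#|I|%:R * e)%:E)%E).
  rewrite sumEFin -EFinD lee_fin /lower_sum -mulr_sumr [#|I|%:R * e]mulrC.
  by rewrite -mulrDr ler_pM2l// addrC (le_trans dropK)// lerD2l.
by apply: leeD => //; apply: lee_sum => k _; exact: lower_sum_le_choquet.
Qed.

End submodular.

(** * Jensen inequality *)

(** Average over j of the tangent inequality
    y_j^p >= a^p + p a^(p-1) (y_j - a) at the mean a; this tangent inequality is
    Young's inequality for y_j and a^(p-1). *)
Lemma powR_sum_le (R : realType) (I : finType) (w y : I -> R) (p : R) :
  1 <= p -> (forall j, 0 <= w j) -> \sum_j w j = 1 -> (forall j, 0 <= y j) ->
  (\sum_j w j * y j) `^ p <= \sum_j w j * y j `^ p.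
Proof.
move=> p1 w0 w1 y0; set a := \sum_j w j * y j.
have a0 : 0 <= a by apply: sumr_ge0 => j _; exact: mulr_ge0.
have p0 : 0 < p by lra.
have tangent j : a `^ p + p * a `^ (p - 1) * (y j - a) <= y j `^ p.
  have apE : a `^ (p - 1) * a = a `^ p by rewrite mulrC mulr_powRB1.
  have [->|pn1] := eqVneq p 1.
    by rewrite !powRr1// subrr powRr0; lra.
  have p1' : 1 < p by rewrite lt_neqAle eq_sym pn1.
  have q0 : 0 < p / (p - 1) by apply: divr_gt0; lra.
  have := @conjugate_powR _ (y j) (a `^ (p - 1)) p (p / (p - 1)) (y0 j)
    (powR_ge0 _ _) p0 q0.
  rewrite -powRrM [(p - 1) * _](_ : _ = p); last by field; lra.
  move=> /(_ _)/wrap[]; first by field; lra.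
  rewrite -(ler_pM2l p0) => young.
  have -> : a `^ p + p * a `^ (p - 1) * (y j - a)
    = p * (y j * a `^ (p - 1)) - (p - 1) * a `^ p.
    by rewrite -apE; ring.
  move: young.
  have -> : p * (y j `^ p / p + a `^ p / (p / (p - 1)))
     = y j `^ p + (p - 1) * a `^ p by field; lra.
  lra.
apply: (@le_trans _ _ (\sum_j w j * (a `^ p + p * a `^ (p - 1) * (y j - a)))).
  under eq_bigr do rewrite mulrDr mulrCA mulrBr.
  rewrite big_split /= -mulr_suml w1 mul1r -mulr_sumr sumrB -/a.
  by rewrite -mulr_suml w1 mul1r subrr mulr0 addr0.
by apply: ler_sum => j _; exact: ler_wpM2l.
Qed.

Lemma choquet_jensen (R : realType) (d : measure_display)
    (T : measurableType d) (mu : set T -> R) (I : finType) (w : I -> R)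
    (a : I -> T -> R) (p : R) :
  is_capacity mu -> is_submodular mu -> 1 <= p ->
  (forall j, 0 <= w j) -> \sum_j w j = 1 ->
  (forall j, measurable_fun setT (a j)) ->
  (choquet mu setT (fun x => `|\sum_j w j * a j x| `^ p)%R
    <= \sum_j (w j)%:E * choquet mu setT (fun x => `|a j x| `^ p)%R)%E.
Proof.
move=> cap submu p1 w0 w1 ma.
have mpow (f : T -> R) : measurable_fun setT f ->
    measurable_fun setT (fun x => `|f x| `^ p).
  move=> mf; apply: measurableT_comp (measurable_powR p) _.
  exact: measurableT_comp.
have mwa j : measurable_fun setT (fun x => w j * `|a j x| `^ p).
  by apply: measurable_funM => //; exact: mpow.
apply: (@le_trans _ _ (choquet mu setT (fun x => \sum_j w j * `|a j x| `^ p))).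
  apply: choquet_le => //.
  - by apply: mpow; apply: measurable_sum => j; exact: measurable_funM.
  - exact: measurable_sum.
  - move=> x; apply: le_trans (powR_sum_le p1 w0 w1 _); last by move=> j.
    apply: ge0_ler_powR; rewrite ?nnegrE//; first lra.
      by apply: sumr_ge0 => j _; exact: mulr_ge0.
    apply: (le_trans (ler_norm_sum _ _ _)); apply: ler_sum => j _.
    by rewrite normrM ger0_norm.
apply: le_trans (choquet_sum_le cap submu mwa _) _.
  by move=> j x; rewrite mulr_ge0// powR_ge0.
by apply: lee_sum => j _; apply: choquet_scale_le => //; exact: mpow.
Qed.

(** * Exponential moments of the Bernstein weights *)

(** Distributivity for index types that depend on the factor, as for the
    multi-indices with k_i <= n_i. *)
Lemma prod_sum_dffun (R : comPzSemiRingType) (I : finType) (T_ : I -> finType)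
    (F : forall i, T_ i -> R) :
  \prod_i \sum_(j : T_ i) F i j =
  \sum_(k : {dffun forall i, T_ i}) \prod_i F i (k i).
Proof.
transitivity (\prod_i \sum_(j in tagged_with T_ i) untag 0 [ffun j => F i j] j).
  apply: eq_bigr => i _.
  rewrite -(big_tag (fun i => [ffun j => F i j] : T_ i -> R) i).
  by apply: eq_bigr => j _; rewrite ffunE.
rewrite bigA_distr_big_dep -(big_fprod _ _ (fun i => [ffun j => F i j])).
rewrite (reindex (@fprod_of_dffun _ T_)); last exact/onW_bij/fprod_of_dffun_bij.
apply: eq_bigr => k _; apply: eq_bigr => i _.
by rewrite ffunE fprodE.
Qed.

(** Squaring the bound exp(v/2) <= 1 / (1 - v/2) <= 1 + v/2 + 2 (v/2)^2, which
    is valid for v/2 <= 1/2. *)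
Lemma expR_le_quadratic (R : realType) (v : R) :
  `|v| <= 1 -> expR v <= 1 + v + 2 * v ^+ 2.
Proof.
rewrite ler_norml => /andP[v1 v2].
have half_bound : expR (v / 2) <= 1 + v / 2 + 2 * (v / 2) ^+ 2.
  have lower := expR_ge1Dx (- (v / 2)).
  have pos : 0 < 1 - v / 2 by lra.
  rewrite -[v / 2 in leLHS]opprK expRN.
  apply: (@le_trans _ _ (1 - v / 2)^-1).
    by rewrite lef_pV2 ?posrE// ?expR_gt0.
  by rewrite -div1r ler_pdivrMr//; nra.
have -> : expR v = expR (v / 2) ^+ 2.
  by rewrite -expRM_natl; congr expR; field.
have e0 := expR_gt0 (v / 2).
apply: (@le_trans _ _ ((1 + v / 2 + 2 * (v / 2) ^+ 2) ^+ 2)).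
  by rewrite ler_pXn2r// nnegrE; lra.
(* Four times the difference of the two sides is v^2 (1 - v) (v + 3). *)
have : 0 <= v ^+ 2 * ((1 - v) * (v + 3)).
  by rewrite mulr_ge0 ?sqr_ge0// mulr_ge0//; lra.
by lra.
Qed.

Lemma bernstein_basis_ge0 (R : realType) (k n : nat) (x : R) :
  0 <= x <= 1 -> 0 <= bernstein_basis k n x.
Proof. by move=> /andP[x0 x1]; rewrite !mulr_ge0// exprn_ge0// subr_ge0. Qed.

Lemma sum_bernstein_basis_geometric (R : realType) (n : nat) (x a b : R) :
  \sum_(k < n.+1) bernstein_basis k n x * (a ^+ k * b ^+ (n - k)) =
  (x * a + (1 - x) * b) ^+ n.
Proof.
rewrite addrC exprDn; apply: eq_bigr => k _.
by rewrite /bernstein_basis -mulr_natl !exprMn; ring.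
Qed.

Lemma sum_bernstein_basis (R : realType) (n : nat) (x : R) :
  \sum_(k < n.+1) bernstein_basis k n x = 1.
Proof.
have := sum_bernstein_basis_geometric n x 1 1.
rewrite !mulr1 addrC subrK expr1n => <-.
by apply: eq_bigr => k _; rewrite !expr1n !mulr1.
Qed.

(** A Chernoff-type bound, for s = 1 or -1.  With u = s / sqrt n the sum is the
    n-th power of x exp(u (1-x)) + (1-x) exp(-u x), where the first-order terms
    in u cancel, so the base is at most 1 + 2 u^2 <= exp(2 / n). *)
Lemma bernstein_exp_moment (R : realType) (n : nat) (x s : R) :
  (1 <= n)%N -> 0 <= x <= 1 -> s ^+ 2 = 1 ->
  \sum_(k < n.+1) bernstein_basis k n x *
    expR (s * (Num.sqrt n%:R * (k%:R / n%:R - x))) <= expR 2.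
Proof.
move=> n1 /andP[x0 x1] s2.
have n0 : 0 < n%:R :> R by rewrite ltr0n.
set r := Num.sqrt n%:R.
have r2 : r ^+ 2 = n%:R by rewrite sqr_sqrtr ?ltW.
have r1 : 1 <= r by rewrite -sqrtr1 ler_sqrt// ler1n.
have r0 : r != 0 by rewrite gt_eqF//; lra.
pose u := s / r.
have u2 : u ^+ 2 = n%:R^-1 by rewrite /u expr_div_n s2 r2 div1r.
have u_le1 : `|u| <= 1.
  rewrite -(@ler_pXn2r _ 2)// ?nnegrE// real_normK ?num_real// u2 expr1n.
  by rewrite invf_le1// ler1n.
have -> : \sum_(k < n.+1) bernstein_basis k n x *
      expR (s * (r * (k%:R / n%:R - x))) =
    \sum_(k < n.+1) bernstein_basis k n x *
      (expR (u * (1 - x)) ^+ k * expR (- (u * x)) ^+ (n - k)).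
  apply: eq_bigr => k _; rewrite -!expRM_natl -expRD; congr (_ * expR _).
  by rewrite natrB 1?leq_ord// /u -r2; field.
rewrite sum_bernstein_basis_geometric.
have -> : expR 2 = expR (2 * u ^+ 2) ^+ n :> R.
  by rewrite -expRM_natl u2; congr expR; field; rewrite gt_eqF.
apply: lerXn2r; rewrite ?nnegrE ?expR_ge0//.
  by rewrite addr_ge0// mulr_ge0 ?expR_ge0// subr_ge0.
apply: le_trans (expR_ge1Dx _).
have bound v : `|v| <= 1 -> expR (u * v) <= 1 + u * v + 2 * (u * v) ^+ 2.
  by move=> v1; apply: expR_le_quadratic; rewrite normrM mulr_ile1.
have b1 := bound (1 - x) ltac:(by rewrite ler_norml; lra).
have b2 := bound (- x) ltac:(by rewrite ler_norml; lra).
rewrite mulrN in b2.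
apply: (@le_trans _ _ (x * (1 + u * (1 - x) + 2 * (u * (1 - x)) ^+ 2)
   + (1 - x) * (1 - u * x + 2 * (- (u * x)) ^+ 2))).
  by apply: lerD; apply: ler_wpM2l => //; rewrite subr_ge0.
have -> : x * (1 + u * (1 - x) + 2 * (u * (1 - x)) ^+ 2)
   + (1 - x) * (1 - u * x + 2 * (- (u * x)) ^+ 2)
   = 1 + 2 * u ^+ 2 * (x * (1 - x)) by ring.
rewrite lerD2l ler_piMr//; last by nra.
by rewrite mulr_ge0// sqr_ge0.
Qed.

Definition bernstein_weight (R : realType) (N : nat) (n : 'I_N -> nat)
    (x : 'rV[R]_N) (k : {dffun forall i : 'I_N, 'I_(n i).+1}) : R :=
  \prod_(i < N) bernstein_basis (k i) (n i) (x 0 i).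

Definition bernstein_node (R : realType) (N : nat) (n : 'I_N -> nat)
    (k : {dffun forall i : 'I_N, 'I_(n i).+1}) : 'rV[R]_N :=
  \row_(i < N) ((k i)%:R / (n i)%:R).

Definition scaled_distance (R : realType) (N : nat) (n : 'I_N -> nat)
    (x y : 'rV[R]_N) : R :=
  \sum_(i < N) Num.sqrt (n i)%:R * `|y 0 i - x 0 i|.

Section multivariate.
Context (R : realType) (N : nat) (n : 'I_N -> nat) (x : 'rV[R]_N).
Hypotheses (n1 : forall i, (1 <= n i)%N) (cube_x : unit_cube x).

Lemma bernstein_weight_ge0 (k : {dffun forall i : 'I_N, 'I_(n i).+1}) :
  0 <= bernstein_weight x k.
Proof.
by apply: prodr_ge0 => i _; apply: bernstein_basis_ge0; exact: cube_x.
Qed.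

Lemma sum_bernstein_weight :
  \sum_(k : {dffun forall i : 'I_N, 'I_(n i).+1}) bernstein_weight x k = 1.
Proof.
rewrite -(prod_sum_dffun (fun i (j : 'I_(n i).+1) =>
  bernstein_basis j (n i) (x 0 i))) big1// => i _.
exact: sum_bernstein_basis.
Qed.

Lemma bernstein_node_cube (k : {dffun forall i : 'I_N, 'I_(n i).+1}) :
  unit_cube (bernstein_node R k).
Proof.
move=> i; rewrite mxE divr_ge0//= ler_pdivrMr ?ltr0n//.
by rewrite mul1r ler_nat leq_ord.
Qed.

(** The mean factors over the coordinates, and exp|t| <= exp(t) + exp(-t). *)
Lemma bernstein_weight_exp_moment :
  \sum_(k : {dffun forall i : 'I_N, 'I_(n i).+1})
    bernstein_weight x k * expR (scaled_distance n x (bernstein_node R k))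
  <= (2 * expR 2) ^+ N.
Proof.
under eq_bigr => k _ do rewrite /scaled_distance expR_sum -big_split /=.
under eq_bigr => k _ do under eq_bigr => i _ do rewrite mxE.
rewrite -(prod_sum_dffun (fun i (j : 'I_(n i).+1) =>
  bernstein_basis j (n i) (x 0 i) *
  expR (Num.sqrt (n i)%:R * `|j%:R / (n i)%:R - x 0 i|))).
have -> : (2 * expR 2) ^+ N = \prod_(i < N) (2 * expR 2) :> R.
  by rewrite prodr_const card_ord.
apply: ler_prod => i _; apply/andP; split.
  by apply: sumr_ge0 => j _; rewrite mulr_ge0 ?expR_ge0 ?bernstein_basis_ge0.
rewrite mulr_natl mulr2n.
have m1 := @bernstein_exp_moment R (n i) (x 0 i) 1 (n1 i) (cube_x i) (expr1n _ _).
have m2 := @bernstein_exp_moment R (n i) (x 0 i) (-1) (n1 i) (cube_x i)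
  (sqrr_sign _ 1).
apply: le_trans (lerD m1 m2); rewrite -big_split /=.
apply: ler_sum => j _; rewrite -mulrDr.
apply: ler_wpM2l; first exact: bernstein_basis_ge0.
rewrite mul1r mulN1r -mulrN; set t := _ - x 0 i.
have [t0|t0] := leP 0 t.
- by rewrite ger0_norm// lerDl expR_ge0.
- by rewrite ltr0_norm// lerDr expR_ge0.
Qed.

End multivariate.

(** * Increments of a random function *)

(** The p-th power of the modulus of continuity: for p-th means, it can be used
    without taking roots. *)
Definition choquet_oscillation (R : realType) (d : measure_display)
    (T : measurableType d) (mu : set T -> R) (p : R) (N : nat)
    (D : set 'rV[R]_N) (F : 'rV[R]_N -> T -> R) (delta : 'I_N -> R) : \bar R :=
  ereal_sup [set y | exists t s : 'rV[R]_N,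
    [/\ D t, D s, forall i, (`|t 0 i - s 0 i| <= delta i)%R &
        y = choquet mu setT (fun x => (`|F t x - F s x| `^ p)%R)]].

Section random_function.
Context (R : realType) (d : measure_display) (T : measurableType d).
Context (mu : set T -> R) (p : R) (N : nat) (F : 'rV[R]_N -> T -> R).
Hypotheses (cap : is_capacity mu) (submu : is_submodular mu) (p1 : 1 <= p).
Hypothesis mF : forall x, unit_cube x -> measurable_fun setT (F x).

Let cube := @unit_cube R N.
Let dist (x y : 'rV[R]_N) : \bar R :=
  choquet mu setT (fun w => `|F x w - F y w| `^ p)%R.
Let osc := choquet_oscillation mu p cube F.

Lemma measurable_powR_norm (f : T -> R) :
  measurable_fun setT f -> measurable_fun setT (fun w => `|f w| `^ p).
Proof.
move=> mf; apply: measurableT_comp (measurable_powR p) _.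
exact: measurableT_comp.
Qed.

Lemma choquet_increment_ge0 (x y : 'rV[R]_N) :
  cube x -> cube y -> (0 <= dist x y)%E.
Proof.
move=> cx cy; apply: (choquet_ge0 cap); apply: measurable_powR_norm.
by apply: measurable_funB; exact: mF.
Qed.

Lemma choquet_oscillation_ub (delta : 'I_N -> R) (x y : 'rV[R]_N) :
  cube x -> cube y -> (forall i, `|x 0 i - y 0 i| <= delta i) ->
  (dist x y <= osc delta)%E.
Proof. by move=> cx cy xy; apply: ereal_sup_ubound; exists x, y. Qed.

Lemma choquet_oscillation_ge0 (delta : 'I_N -> R) :
  (forall i, 0 <= delta i) -> (0 <= osc delta)%E.
Proof.
move=> delta0; have c0 : cube 0 by move=> i; rewrite mxE lexx ler01.
apply: le_trans (choquet_oscillation_ub c0 c0 _).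
  exact: choquet_increment_ge0.
by move=> i; rewrite subrr normr0.
Qed.

(** The sum of q = m + 1 increments is the mean of q times each of them, and
    Jensen's inequality applies to that mean with the weights 1 / q. *)
Lemma choquet_chain_le (m : nat) (z : nat -> 'rV[R]_N) (c : \bar R) :
  (0 <= c)%E ->
  (forall j, cube (z j)) ->
  (forall j, (j <= m)%N -> dist (z j.+1) (z j) <= c)%E ->
  (dist (z m.+1) (z 0%N) <= (m.+1%:R `^ p)%:E * c)%E.
Proof.
move=> c0 cz step.
set q := m.+1%:R : R.
have q0 : 0 < q by rewrite ltr0n.
have w0 (j : 'I_m.+1) : 0 <= q^-1 by rewrite invr_ge0 ltW.
have w1 : \sum_(j < m.+1) q^-1 = 1.
  by rewrite sumr_const card_ord -mulr_natl divff// gt_eqF.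
pose incr j w := F (z j.+1) w - F (z j) w.
have mincr j : measurable_fun setT (incr j).
  by apply: measurable_funB; apply: mF; exact: cz.
have mqincr (j : 'I_m.+1) : measurable_fun setT (fun w => q * incr j w).
  exact: measurable_funM.
have -> : dist (z m.+1) (z 0%N) = choquet mu setT
    (fun w => `|\sum_(j < m.+1) q^-1 * (q * incr j w)| `^ p).
  congr choquet; apply/funext => w; congr (`|_| `^ p).
  under eq_bigr do rewrite mulrA mulVf ?gt_eqF// mul1r.
  by rewrite -(big_mkord xpredT (fun j => incr j w)) telescope_sumr.
apply: (le_trans (choquet_jensen cap submu p1 w0 w1 mqincr)).
have -> : ((q `^ p)%:E * c = \sum_(j < m.+1) q^-1%:E * ((q `^ p)%:E * c))%E.
  have sumw : (\sum_(j < m.+1) q^-1%:E = 1 :> \bar R)%E by rewrite sumEFin w1.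
  rewrite -[LHS]mul1e -[in LHS]sumw ge0_sume_distrl// => j _.
  by rewrite lee_fin w0.
apply: lee_sum => j _; apply: lee_pmul => //.
- by rewrite lee_fin w0.
- by apply: (choquet_ge0 cap); exact: measurable_powR_norm.
have -> : (fun w => `|q * incr j w| `^ p) = (fun w => q `^ p * `|incr j w| `^ p).
  by apply/funext => w; rewrite normrM powRM// gtr0_norm.
apply: le_trans (choquet_scale_le cap _ (powR_ge0 _ _)) _.
  exact: measurable_powR_norm.
apply: lee_pmul => //.
- by rewrite lee_fin powR_ge0.
- by apply: (choquet_ge0 cap); exact: measurable_powR_norm.
by apply: step; rewrite -ltnS.
Qed.

(** The segment from x to y is cut into m + 1 equal steps, which stay in the
    cube by convexity. *)
Lemma choquet_increment_le (delta : 'I_N -> R) (m : nat) (x y : 'rV[R]_N) :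
  (forall i, 0 <= delta i) -> cube x -> cube y ->
  (forall i, `|y 0 i - x 0 i| <= m.+1%:R * delta i) ->
  (dist y x <= (m.+1%:R `^ p)%:E * osc delta)%E.
Proof.
move=> delta0 cx cy xy.
(* The cut at m + 1 keeps every point of the sequence in the cube. *)
pose a (j : nat) : R := (minn j m.+1)%:R / m.+1%:R.
have a01 j : 0 <= a j <= 1.
  rewrite divr_ge0//= ler_pdivrMr ?ltr0n// mul1r ler_nat; exact: geq_minr.
pose z j := x + a j *: (y - x).
have cz j : cube (z j).
  move=> i; rewrite !mxE; have /andP[aj0 aj1] := a01 j.
  by have /andP[x0 x1] := cx i; have /andP[y0 y1] := cy i; apply/andP; split; nra.
have z0 : z 0%N = x by rewrite /z /a min0n mul0r scale0r addr0.
have zm : z m.+1 = y.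
  by rewrite /z /a minnn divff ?pnatr_eq0// scale1r addrC subrK.
rewrite -[in leLHS]zm -[in leLHS]z0.
apply: choquet_chain_le.
- exact: choquet_oscillation_ge0.
- exact: cz.
move=> j jm; apply: choquet_oscillation_ub => // i; rewrite !mxE.
have -> : x 0 i + a j.+1 * (y 0 i - x 0 i) - (x 0 i + a j * (y 0 i - x 0 i))
   = (a j.+1 - a j) * (y 0 i - x 0 i) by ring.
have -> : a j.+1 - a j = m.+1%:R^-1.
  rewrite /a (minn_idPl _) ?ltnS// (minn_idPl _) ?(leq_trans jm)//.
  by rewrite -mulrBl -natrB// subSnn mul1r.
by rewrite normrM ger0_norm ?invr_ge0// mulrC ler_pdivrMr ?ltr0n// mulrC.
Qed.

Lemma choquet_increment_sym (x y : 'rV[R]_N) : dist x y = dist y x.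
Proof. by congr choquet; apply/funext => w; rewrite distrC. Qed.

(** * The Bernstein error *)

(** The node k/n is reached from x in m + 1 steps, where m is the integer part of
    the scaled distance.  From q/p <= exp(q/p) for q = m + 1 one gets
    q^p <= p^p exp(q), and the exponential moment bounds the weighted mean. *)
Lemma choquet_bernstein_error_le (n : 'I_N -> nat) (x : 'rV[R]_N) :
  (forall i, (1 <= n i)%N) -> cube x ->
  (choquet mu setT (fun w => `|F x w - random_bernstein n F x w| `^ p)%R
    <= (p `^ p * expR 1 * (2 * expR 2) ^+ N)%:E
       * osc (fun i => 1 / Num.sqrt (n i)%:R)%R)%E.
Proof.
move=> n1 cx.
have sqn0 i : 0 < Num.sqrt (n i)%:R :> R by rewrite sqrtr_gt0 ltr0n.
set delta := fun i => 1 / Num.sqrt (n i)%:R.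
have delta0 i : 0 <= delta i by rewrite /delta divr_ge0// ltW.
pose grid := {dffun forall i : 'I_N, 'I_(n i).+1}.
pose node (k : grid) := bernstein_node R k.
pose W (k : grid) := bernstein_weight x k.
have cnode (k : grid) : cube (node k) by exact: bernstein_node_cube.
have W0 (k : grid) : 0 <= W k by exact: bernstein_weight_ge0.
have mincr (k : grid) : measurable_fun setT (fun w => F x w - F (node k) w).
  by apply: measurable_funB; apply: mF; [exact: cx|exact: cnode].
have -> : (fun w => `|F x w - random_bernstein n F x w| `^ p) =
    (fun w => `|\sum_k W k * (F x w - F (node k) w)| `^ p).
  apply/funext => w; congr (`|_| `^ p).
  under [RHS]eq_bigr do rewrite mulrBr.
  by rewrite sumrB -mulr_suml sum_bernstein_weight// mul1r.
apply: (le_trans (choquet_jensen cap submu p1 W0 (sum_bernstein_weight n x) mincr)).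
have p0 : 0 < p := lt_le_trans ltr01 p1.
have node_dist (k : grid) : (dist x (node k) <=
    (p `^ p * expR 1 * expR (scaled_distance n x (node k)))%:E * osc delta)%E.
  set y := scaled_distance n x (node k).
  have y0 : 0 <= y by apply: sumr_ge0 => i _; rewrite mulr_ge0// ltW.
  pose m := Num.truncn y.
  have my : m%:R <= y by rewrite truncn_le.
  have ym : y <= m.+1%:R by rewrite ltW// truncnS_gt.
  rewrite choquet_increment_sym.
  apply: (@le_trans _ _ ((m.+1%:R `^ p)%:E * osc delta)%E).
    apply: choquet_increment_le => // i.
    rewrite /delta mulrA mulr1 ler_pdivlMr// mulrC (le_trans _ ym)//.
    rewrite /y /scaled_distance (bigD1 i)//= lerDl.
    by apply: sumr_ge0 => j _; exact: mulr_ge0.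
  apply: lee_wpmul2r; first exact: choquet_oscillation_ge0.
  rewrite lee_fin.
  have mp0 : 0 <= m.+1%:R / p by rewrite divr_ge0// ltW.
  have -> : m.+1%:R = p * (m.+1%:R / p) by field; rewrite gt_eqF.
  rewrite powRM// ?(ltW p0)// -mulrA ler_pM2l ?powR_gt0//.
  apply: (@le_trans _ _ (expR (m.+1%:R / p) `^ p)).
    apply: ge0_ler_powR; rewrite ?nnegrE ?expR_ge0 ?(ltW p0)//.
    by apply: le_trans (expR_ge1Dx _); rewrite lerDr.
  rewrite -expRM divfK ?gt_eqF// -expRD ler_expR -natr1; lra.
apply: (@le_trans _ _ (\sum_(k : grid) (W k)%:E *
  ((p `^ p * expR 1 * expR (scaled_distance n x (node k)))%:E * osc delta))%E).
  apply: lee_sum => k _; apply: lee_pmul => //.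
  - by rewrite lee_fin.
  - exact: choquet_increment_ge0.
  - exact: node_dist.
under eq_bigr => k _ do rewrite muleA -EFinM.
rewrite -ge0_sume_distrl; last first.
  by move=> k _; rewrite lee_fin !mulr_ge0 ?expR_ge0 ?powR_ge0.
apply: lee_pmul => //.
- by apply: sume_ge0 => k _; rewrite lee_fin !mulr_ge0 ?expR_ge0 ?powR_ge0.
- exact: choquet_oscillation_ge0.
rewrite sumEFin lee_fin.
under eq_bigr => k _ do rewrite mulrCA.
rewrite -mulr_sumr; apply: ler_wpM2l.
  by rewrite mulr_ge0 ?expR_ge0 ?powR_ge0.
exact: bernstein_weight_exp_moment.
Qed.

(** * Uniform continuity in the mean *)

Lemma euclidean_norm_le (v : 'rV[R]_N) (r : R) :
  0 <= r -> (forall i, `|v 0 i| <= r) -> euclidean_norm v <= N%:R * r.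
Proof.
move=> r0 vr; have Nr0 : 0 <= N%:R * r by exact: mulr_ge0.
rewrite -[leRHS]ger0_norm// -sqrtr_sqr ler_sqrt ?sqr_ge0//.
apply: (@le_trans _ _ (\sum_(i < N) r ^+ 2)).
  by apply: ler_sum => i _; rewrite -[leLHS]real_normK ?num_real// lerXn2r ?nnegrE.
rewrite sumr_const card_ord -[leLHS]mulr_natl exprMn.
apply: ler_wpM2r; first exact: sqr_ge0.
by rewrite -natrX ler_nat; case: (N) => // m; rewrite leq_pmulr.
Qed.

Lemma unit_cube_compact : compact cube.
Proof.
have -> : cube = [set v | forall i, (`[0, 1]%classic : set R) (v ord0 i)].
  by apply/seteqP; split=> v /= cv i; have := cv i; rewrite /= in_itv.
exact: (@rV_compact R N (fun=> `[0, 1]%classic) (fun=> @segment_compact R 0 1)).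
Qed.

(** Uniformity by the near-covering form of compactness: if x and t are both
    close to x0 in the mean, a chain of two steps through x0 bounds the increment
    between x and t, at the cost of the factor 2^p; hence the target
    eps / 2^p at x0. *)
Lemma choquet_oscillation_small (eps : R) :
  (forall x, cube x -> choquet_mean_continuous_at mu p cube F x) -> 0 < eps ->
  exists2 r : R, 0 < r & forall delta : 'I_N -> R,
    (forall i, delta i <= r) -> (osc delta <= eps%:E)%E.
Proof.
move=> contF eps0.
pose uniform (r : R) (x : 'rV[R]_N) := forall t, cube x -> cube t ->
  (forall i, `|t 0 i - x 0 i| <= r) -> (dist t x <= eps%:E)%E.
have two_p : 0 < 2 `^ p :> R by exact: powR_gt0.
have /compact_near_coveringP/(_ _ (0:R)^'+ uniform _) := unit_cube_compact.
move=> /(_ _)/wrap[x0 cx0|].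
  have [rho rho0 near_x0] := contF x0 cx0 (eps / 2 `^ p) (divr_gt0 eps0 two_p).
  (* Coordinatewise distance at most 2 r0 gives Euclidean distance below rho. *)
  pose r0 := rho / (2 * N%:R + 1).
  have N0 : 0 <= N%:R :> R by [].
  have r00 : 0 < r0 by apply: divr_gt0 => //; lra.
  have close t : cube t -> (forall i, `|t 0 i - x0 0 i| <= 2 * r0) ->
      (dist t x0 <= (eps / 2 `^ p)%:E)%E.
    move=> ct tx0; apply/ltW/near_x0 => //.
    apply: le_lt_trans (@euclidean_norm_le _ (2 * r0) _ _) _.
    - by rewrite mulr_ge0// ltW.
    - by move=> i; rewrite !mxE; exact: tx0.
    rewrite /r0 !mulrA ltr_pdivrMr; last lra.
    by rewrite [ltRHS]mulrC ltr_pM2r//; lra.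
  exists (ball x0 r0, [set r | r < r0]).
    split; first exact: nbhsx_ballx.
    by apply: nbhs_right_lt.
  move=> [x r] /= [x0x rr0] t cx ct tx.
  have x0x' i : `|x 0 i - x0 0 i| <= r0.
    by case: x0x => _ /(_ 0 i); rewrite /ball/= distrC => /ltW.
  have := @choquet_chain_le 1 (fun j => if j is 0%N then x else
     if j is 1%N then x0 else t) (eps / 2 `^ p)%:E.
  rewrite /= -EFinM [2 `^ p * _]mulrC divfK ?gt_eqF//; apply.
  - by rewrite lee_fin divr_ge0// ltW.
  - by move=> [|[|j]].
  move=> [|[|//]] _.
  - rewrite choquet_increment_sym; apply: close => // i.
    by rewrite (le_trans (x0x' i))//; lra.
  - apply: close => // i.
    have := tx i; have := x0x' i; rewrite !ler_norml; lra.
move=> near_uniform.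
have [r /andP[r0 ru]] : exists r : R, (0 < r) && `[< cube `<=` uniform r >].
  near (0:R)^'+ => r; exists r; apply/andP; split.
    by near: r; exact: nbhs_right_gt.
  by apply/asboolP; near: r; exact: near_uniform.
exists r => // delta delta_le; apply: ge_ereal_sup => _ [t [s [ct cs ts ->]]].
move/asboolP: ru => /(_ s cs t cs ct); apply => i.
exact: le_trans (ts i) (delta_le i).
Unshelve. all: by end_near.
Qed.

End random_function.

(** * The theorem *)

Theorem theorem2 (R : realType) (N : nat) (hN : (1 <= N)%N) (p : R)
    (hp : 1 <= p) :
  exists2 Cp : R, 0 < Cp &
  forall (d : measure_display) (Omega : measurableType d)
    (mu : set Omega -> R) (F : 'rV[R]_N -> Omega -> R),
  is_capacity mu -> is_submodular mu ->
  random_function_Lp mu p (@unit_cube R N) F ->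
  (forall (x : 'rV[R]_N) (n : 'I_N -> nat),
     unit_cube x -> (forall i, (1 <= n i)%N) ->
     ((choquet mu setT
         (fun omega => (`|F x omega - random_bernstein n F x omega| `^ p)%R))
        `^ p^-1
      <= (Cp `^ p^-1)%:E *
         choquet_modulus mu p (@unit_cube R N) F
           (fun i => (1 / Num.sqrt (n i)%:R)%R))%E)
  /\
  ((forall x : 'rV[R]_N, unit_cube x ->
      choquet_mean_continuous_at mu p (@unit_cube R N) F x) ->
   forall eps : R, 0 < eps ->
   exists2 n0 : nat, (1 <= n0)%N &
   forall (x : 'rV[R]_N) (n : 'I_N -> nat),
     unit_cube x -> (forall i, (n0 <= n i)%N) ->
     (choquet mu setT
        (fun omega => (`|random_bernstein n F x omega - F x omega| `^ p)%R)
      < eps%:E)%E).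
Proof.
pose Cp : R := p `^ p * expR 1 * (2 * expR 2) ^+ N.
have Cp0 : 0 < Cp.
  by rewrite !mulr_gt0 ?exprn_gt0 ?mulr_gt0 ?powR_gt0 ?expR_gt0//; lra.
exists Cp => // d Omega mu F cap submu LpF.
have mF x : unit_cube x -> measurable_fun setT (F x) by move=> /LpF[].
have p_inv0 : 0 <= p^-1 by rewrite invr_ge0; lra.
split=> [x n cx n1|contF eps eps0].
  have delta0 i : 0 <= 1 / Num.sqrt (n i)%:R :> R by rewrite divr_ge0// sqrtr_ge0.
  have error_le := choquet_bernstein_error_le cap submu hp mF n1 cx.
  have osc0 := choquet_oscillation_ge0 p cap mF delta0.
  rewrite -poweR_EFin -poweRM ?lee_fin ?(ltW Cp0)//.
  apply: gt0_ler_poweR => //; rewrite in_itv/= leey andbT.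
    apply: (choquet_ge0 cap); apply: measurable_powR_norm.
    apply: measurable_funB; first exact: mF.
    apply: measurable_sum => k; apply: measurable_funM => //.
    by apply: mF; exact: bernstein_node_cube.
  by rewrite mule_ge0// lee_fin ltW.
have eta0 : 0 < eps / (2 * Cp) by rewrite divr_gt0// mulr_gt0.
have [r r0 osc_le] := choquet_oscillation_small cap submu hp mF contF eta0.
(* This choice gives 1 / sqrt(n_i) <= r as soon as n_i >= n0. *)
exists (Num.truncn (r^-1 ^+ 2)).+1 => // x n cx n0n.
have n1 i : (1 <= n i)%N by exact: leq_trans (n0n i).
have -> : (fun omega => `|random_bernstein n F x omega - F x omega| `^ p) =
    (fun omega => `|F x omega - random_bernstein n F x omega| `^ p).
  by apply/funext => omega; rewrite distrC.
apply: le_lt_trans (choquet_bernstein_error_le cap submu hp mF n1 cx) _.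
apply: (@le_lt_trans _ _ (Cp%:E * (eps / (2 * Cp))%:E)%E).
  apply: lee_wpmul2l; first by rewrite lee_fin ltW.
  apply: osc_le => i.
  rewrite div1r invf_ple ?posrE ?sqrtr_gt0 ?ltr0n//.
  rewrite -[leLHS]gtr0_norm ?invr_gt0// -sqrtr_sqr ler_sqrt//.
  rewrite (le_trans (ltW (truncnS_gt _)))// ler_nat; exact: n0n.
rewrite -EFinM lte_fin.
have -> : Cp * (eps / (2 * Cp)) = eps / 2 by field; rewrite gt_eqF.
lra.
Qed.
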